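(* For a bounded lattice $L$ and a cardinality $\kappa$, consider the following conditions. $(1)_{\kappa}$: for every $U\subseteq L$ with $|U|\le\kappa$ there is $e\in\mathcal B(L)$ with $\mathrm{Ann}_L(U)=(e]_L$ (that is, $L$ is $\kappa$-Stone). $(1)_{<\infty}$: the same for every finite $U\subseteq L$. $(1)$: the same for every $U\subseteq L$ (that is, $L$ is strongly Stone). $(2)_{\kappa}$ (respectively $(2)_{<\infty}$, respectively $(2)$): $L$ is a Stone lattice and $\mathcal B(L)$ is a $\kappa$-complete Boolean sublattice (respectively a Boolean sublattice, respectively a complete Boolean sublattice) of $L$. $(3)_{\kappa}$ (respectively $(3)_{<\infty}$, respectively $(3)$): $\mathrm{P2Ann}(L)$ is a $\kappa$-complete Boolean sublattice (respectively a Boolean sublattice, respectively a complete Boolean sublattice) of $\mathrm{Id}(L)$ such that $a\mapsto \mathrm{Ann}_L(\mathrm{Ann}_L(a))$ is a lattice morphism from $L$ to $\mathrm{P2Ann}(L)$. $(4)_{\kappa}$ (respectively $(4)_{<\infty}$, respectively $(4)$): $\mathrm{Ann}_L(a\wedge b)=(\mathrm{Ann}_L(a)\cup\mathrm{Ann}_L(b)]_L$ for all $a,b\in L$, and $\mathrm{Ann}_L(\mathrm{Ann}_L(U))\in\mathrm{PAnn}(L)$ for every $U\subseteq L$ with $|U|\le\kappa$ (respectively every finite $U\subseteq L$, respectively every $U\subseteq L$). $(iv)$: $\mathrm{Ann}_L(a\wedge b)=(\mathrm{Ann}_L(a)\cup\mathrm{Ann}_L(b)]_L$ for all $a,b\in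 L$. $(5)_{\kappa}$ (respectively $(5)_{<\infty}$, respectively $(5)$): $(\mathrm{Ann}_L(U)\cup\mathrm{Ann}_L(\mathrm{Ann}_L(U))]_L=L$ for every $U\subseteq L$ with $|U|\le\kappa$ (respectively every finite $U\subseteq L$, respectively every $U\subseteq L$). Let $(L,\vee,\wedge,[\cdot,\cdot],0,1)$ be a commutator lattice with $\rho(0)=0$, and consider the congruence $\equiv\;=\{(a,b)\in L^2:\rho(a)=\rho(b)\}$ of $L$. If $1/\!\equiv\;=\{1\}$ and $[x,1]=x$ for all $x\in L$, in particular if $1$ is a compact element of $L$ and $[x,1]=x$ for all $x\in L$, then: (i) For any $h,i,j\in\{1,\dots,5\}$ and any nonzero cardinality $\kappa$, conditions $(iv)$, $(h)_\kappa$, $(i)_{<\infty}$ (condition number $i$ in its finite version) and $(j)$ are equivalent. Thus the following are equivalent: $L$ is Stone; $L$ is strongly Stone and $\mathcal B(L)$ is a complete Boolean sublattice of $L$; $(3)_{<\infty}$; $(3)$; $\mathrm{Ann}_L(a\wedge b)=\mathrm{Ann}_L(a)\vee\mathrm{Ann}_L(b)$ for all $a,b\in L$; $\mathrm{Ann}_L(a)\vee\mathrm{Ann}_L(\mathrm{Ann}_L(a))=L$ for all $a\in L$. (ii) Let $m$ be a nonzero cardinality. If, in the definition of a commutator lattice, the conditions that $L$ is complete and that $[\cdot,\cdot]$ is completely distributive with respect to the join are replaced by the conditions that $L$ is closed with respect to the joins of all families of elements of cardinality at most $m$ and that $[\cdot,\cdot]$ is distributive with respect to such joins (the other hypotheses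 above being kept), then, for any $h,i\in\{1,\dots,5\}$ and any nonzero cardinality $\kappa\le m$, conditions $(h)_\kappa$ and $(i)_{<\infty}$ are equivalent. Thus the following are equivalent: $L$ is Stone; $L$ is $m$-Stone and $\mathcal B(L)$ is an $m$-complete Boolean sublattice of $L$; $(3)_{<\infty}$; $(3)_m$; $\mathrm{Ann}_L(a\wedge b)=\mathrm{Ann}_L(a)\vee\mathrm{Ann}_L(b)$ for all $a,b\in L$ and $\mathrm{P2Ann}(L)\subseteq\mathrm{PAnn}(L)$; $\mathrm{Ann}_L(a)\vee\mathrm{Ann}_L(\mathrm{Ann}_L(a))=L$ for all $a\in L$.
   Context: A commutator lattice is an algebra $(L,\vee,\wedge,[\cdot,\cdot],0,1)$ such that $(L,\vee,\wedge,0,1)$ is a complete lattice with bounds $0,1$ and $[\cdot,\cdot]$ is a binary operation on $L$ with $[x,y]=[y,x]\le x\wedge y$ and $[x,\bigvee_{i\in I}y_i]=\bigvee_{i\in I}[x,y_i]$ (complete distributivity with respect to the join) for all $x,y\in L$ and all families $(y_i)_{i\in I}\subseteq L$. An element $p\in L\setminus\{1\}$ is prime if, for all $a,b\in L$, $[a,b]\le p$ implies $a\le p$ or $b\le p$. $V(x)$ is the set of prime elements $p$ with $x\le p$, and $\rho(x)=\bigwedge V(x)$ (with $\bigwedge\emptyset=1$). The relation $\equiv\;=\{(a,b)\in L^2:\rho(a)=\rho(b)\}$ is a lattice congruence of a commutator lattice $L$, and $x/\!\equiv$ is the class of $x$. In part (ii), $\rho$ and $\equiv$ are given by the same formulas.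 For a bounded lattice $L$: $\mathcal B(L)$ is the set of its complemented elements; $(U]_L$ is the ideal generated by $U\subseteq L$, and $(a]_L=(\{a\}]_L$; $\mathrm{Id}(L)$ is the lattice of ideals of $L$, with join $\vee$, so $I\vee J=(I\cup J]_L$. $\mathrm{Ann}_L(a)=\{x\in L: x\wedge a=0\}$, $\mathrm{Ann}_L(U)=\bigcap_{u\in U}\mathrm{Ann}_L(u)$, $\mathrm{PAnn}(L)=\{\mathrm{Ann}_L(a): a\in L\}$, $\mathrm{P2Ann}(L)=\{\mathrm{Ann}_L(\mathrm{Ann}_L(a)): a\in L\}$. $L$ is Stone if for each $a\in L$ there is $e\in\mathcal B(L)$ with $\mathrm{Ann}_L(a)=(e]_L$. A Boolean sublattice is a bounded sublattice that is a Boolean algebra; it is $\kappa$-complete (complete) if each of its subsets of cardinality at most $\kappa$ (each of its subsets) has a supremum and an infimum in that Boolean algebra.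
   Formalization: In part (ii), [·,·] is also assumed to distribute over binary joins; this is automatic for m ≥ 2, but for m = 1 it is an added hypothesis, without which the claim fails (the pentagon N5 with [x,y] = x∧y satisfies (1)_1 but not (2)_{<∞}). *)

(* Defs.v *)
From HB Require Import structures.
From mathcomp Require Import all_boot all_order.
From mathcomp Require Import mathcomp_extra boolp classical_sets functions.
From mathcomp Require Import cardinality.

Set Implicit Arguments.
Unset Strict Implicit.
Unset Printing Implicit Defensive.

Import Order.TTheory.
Local Open Scope classical_set_scope.
Local Open Scope order_scope.

(* A cardinality is represented by a type having that cardinality. *)
Variant size_bound := AtMost of Type | FiniteSize | AnySize.

Definition small (b : size_bound) (T : Type) (U : set T) : Prop :=
  match b with
  | AtMost K => (U #<= [set: K])%card
  | FiniteSize => finite_set U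
  | AnySize => True
  end.

Section Sublattices.
Context {d : Order.disp_t} {L : tbLatticeType d}.
Implicit Types S U : set L.

Definition complemented : set L :=
  [set x | exists y, x `&` y = \bot /\ x `|` y = \top].

Record boolean_sublattice S : Prop := BooleanSublattice {
  bsub_bot : S \bot;
  bsub_top : S \top;
  bsub_meet : forall x y, S x -> S y -> S (x `&` y);
  bsub_join : forall x y, S x -> S y -> S (x `|` y);
  bsub_distr : forall x y z, S x -> S y -> S z ->
    x `&` (y `|` z) = (x `&` y) `|` (x `&` z);
  bsub_compl : forall x, S x ->
    exists2 y, S y & x `&` y = \bot /\ x `|` y = \top
}.

(* Suprema and infima are taken in the ordered set S, not in L. *)
Definition has_sup_in S U :=
  exists s, [/\ S s, ubound U s & forall t, S t -> ubound U t -> s <= t].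

Definition has_inf_in S U :=
  exists s, [/\ S s, lbound U s & forall t, S t -> lbound U t -> t <= s].

Definition complete_boolean_sublattice (b : size_bound) S : Prop :=
  boolean_sublattice S /\
  match b with
  | FiniteSize => True
  | _ => forall U, (U `<=` S)%classic -> small b U ->
           has_sup_in S U /\ has_inf_in S U
  end.

Definition compact_element (a : L) := forall U s,
  supremums U s -> a <= s ->
  exists2 F : seq L, (forall x, x \in F -> U x) & a <= \join_(x <- F) x.

End Sublattices.

Arguments complemented {d} L.

Section Ideals.
Context {d : Order.disp_t} {L : tbLatticeType d}.

Record is_ideal (I : set L) : Prop := IsIdeal {
  ideal_bot : I \bot;
  ideal_down : forall x y, x <= y -> I y -> I x;
  ideal_join : forall x y, I x -> I y -> I (x `|` y)
}.

Definition ideal_gen (U : set L) : set L := smallest is_ideal U.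

Lemma ideal_gen_ideal U : is_ideal (ideal_gen U).
Proof.
split=> [I [[]]|x y xy Uy I [iI UI]|x y Ux Uy I [iI UI]] //.
- by apply: ideal_down xy _ => //; exact: Uy.
- by apply: ideal_join => //; [exact: Ux|exact: Uy].
Qed.

Record ideal := Ideal { ideal_set :> set L ; ideal_setP : is_ideal ideal_set }.

Lemma ideal_inj : injective ideal_set.
Proof.
by move=> [I iI] [J iJ] /= IJ; subst J; congr Ideal; exact: Prop_irrelevance.
Qed.

HB.instance Definition _ := gen_eqMixin ideal.
HB.instance Definition _ := gen_choiceMixin ideal.

Definition ideal_le (I J : ideal) : bool := `[< (I `<=` J)%classic >].

Lemma ideal_le_refl : reflexive ideal_le.
Proof. by move=> I; apply/asboolP. Qed.

Lemma ideal_le_anti : antisymmetric ideal_le.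
Proof.
move=> I J /andP[/asboolP IJ /asboolP JI].
by apply: ideal_inj; rewrite eqEsubset.
Qed.

Lemma ideal_le_trans : transitive ideal_le.
Proof.
move=> J I K /asboolP IJ /asboolP JK.
by apply/asboolP; exact: subset_trans JK.
Qed.

HB.instance Definition _ := Order.Le_isPOrder.Build d ideal
  ideal_le_refl ideal_le_anti ideal_le_trans.

Lemma ideal_leP (I J : ideal) : reflect (I `<=` J)%classic (I <= J).
Proof. exact: asboolP. Qed.

Lemma ideal_setI (I J : ideal) : is_ideal (ideal_set I `&` J)%classic.
Proof.
case: I J => [I [I0 Id Iu]] [J [J0 Jd Ju]] /=.
split=> [//|x y xy [Iy Jy]|x y [Ix Jx] [Iy Jy]]; split.
- exact: Id xy Iy.
- exact: Jd xy Jy.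
- exact: Iu.
- exact: Ju.
Qed.

Definition ideal_meet (I J : ideal) : ideal := Ideal (ideal_setI I J).

Lemma ideal_lexI (I J K : ideal) :
  (I <= ideal_meet J K) = (I <= J) && (I <= K).
Proof.
apply/ideal_leP/andP => [IJK|[/ideal_leP IJ /ideal_leP IK] x Ix].
- by split; apply/ideal_leP => x /IJK [].
- by split; [exact: IJ|exact: IK].
Qed.

HB.instance Definition _ :=
  Order.POrder_isMeetSemilattice.Build d ideal ideal_lexI.

Definition ideal_lub (I J : ideal) : ideal :=
  Ideal (ideal_gen_ideal (ideal_set I `|` J)%classic).

Lemma ideal_leUx (I J K : ideal) :
  (ideal_lub I J <= K) = (I <= K) && (J <= K).
Proof.
apply/ideal_leP/andP => [IJK|[/ideal_leP IK /ideal_leP JK] x].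
- by split; apply/ideal_leP => x Ix; apply: IJK => M [_]; apply;
    [left|right].
- by apply; split; [exact: ideal_setP|move=> y [/IK|/JK]].
Qed.

HB.instance Definition _ :=
  Order.POrder_isJoinSemilattice.Build d ideal ideal_leUx.

Lemma ideal_set_bot : is_ideal [set \bot : L].
Proof.
split=> // [x y xy /= y0|x y /= -> ->]; last by rewrite joinxx.
by apply/eqP; rewrite -lex0 -y0.
Qed.

Lemma ideal_setT : is_ideal [set: L].
Proof. by []. Qed.

Lemma ideal_le0x (I : ideal) : Ideal ideal_set_bot <= I.
Proof. by apply/ideal_leP => x ->; case: (ideal_setP I). Qed.

Lemma ideal_lex1 (I : ideal) : I <= Ideal ideal_setT.
Proof. exact/ideal_leP. Qed.

HB.instance Definition _ := Order.hasBottom.Build d ideal ideal_le0x.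
HB.instance Definition _ := Order.hasTop.Build d ideal ideal_lex1.

End Ideals.

Arguments ideal {d} L.

Section Annihilators.
Context {d : Order.disp_t} (L : tbLatticeType d).

Definition ann (a : L) : set L := [set x | x `&` a = \bot].

(* In particular Ann set0 is the whole of L. *)
Definition Ann (U : set L) : set L := \bigcap_(u in U) ann u.

Definition PAnn : set (set L) := [set ann a | a in [set: L]].

Definition P2Ann : set (set L) := [set Ann (ann a) | a in [set: L]].

Definition stone : Prop :=
  forall a : L, exists2 e, complemented L e & ann a = ideal_gen [set e].

Definition condition1 (b : size_bound) : Prop :=
  forall U : set L, small b U ->
    exists2 e, complemented L e & Ann U = ideal_gen [set e].

Definition condition2 (b : size_bound) : Prop :=
  stone /\ complete_boolean_sublattice b (complemented L).

(* Over an arbitrary bounded lattice Ann (ann a) need not be an ideal; the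
   existence of AA says that P2Ann is contained in the lattice of ideals.
   Since P2Ann is then required to be a sublattice of ideal L, the operations
   preserved by AA are those of ideal L. *)
Definition condition3 (b : size_bound) : Prop :=
  exists AA : L -> ideal L,
    [/\ forall a, AA a = Ann (ann a) :> set L,
        complete_boolean_sublattice b [set I : ideal L | P2Ann (ideal_set I)],
        Order.meet_morphism AA
      & Order.join_morphism AA].

Definition condition_iv : Prop :=
  forall a b : L, ann (a `&` b) = ideal_gen (ann a `|` ann b)%classic.

Definition condition4 (b : size_bound) : Prop :=
  condition_iv /\ forall U : set L, small b U -> PAnn (Ann (Ann U)).

Definition condition5 (b : size_bound) : Prop :=
  forall U : set L, small b U ->
    ideal_gen (Ann U `|` Ann (Ann U))%classic = [set: L].

Definition condition (n : nat) (b : size_bound) : Prop :=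
  match n with
  | 1 => condition1 b
  | 2 => condition2 b
  | 3 => condition3 b
  | 4 => condition4 b
  | 5 => condition5 b
  | _ => False
  end.

End Annihilators.

Arguments PAnn {d} L.
Arguments P2Ann {d} L.

Section Commutators.
Context {d : Order.disp_t} {L : tbLatticeType d}.
Implicit Types c : L -> L -> L.

(* The joins of families of elements are rendered as the suprema of their
   sets of values. *)
Record commutator_operation (b : size_bound) c : Prop := CommutatorOperation {
  commutatorC : forall x y, c x y = c y x;
  commutator_le : forall x y, c x y <= x `&` y;
  commutator_sup : forall x (Y : set L) s, small b Y ->
    supremums Y s -> supremums [set c x y | y in Y] (c x s)
}.

Definition commutator_lattice c : Prop :=
  (forall U : set L,
     (exists s, supremums U s) /\ (exists s, infimums U s)) /\
  commutator_operation AnySize c.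

(* The last clause follows from the previous one except when M has at most one
   element; in that case it makes c distribute over the lattice operation
   `|`, which families of at most one element do not see. *)
Definition small_commutator_lattice (M : Type) c : Prop :=
  [/\ forall U : set L, small (AtMost M) U -> exists s, supremums U s,
      commutator_operation (AtMost M) c
    & forall x y z, c x (y `|` z) = c x y `|` c x z].

Definition commutator_prime c (p : L) : Prop :=
  p <> \top /\ forall a b, c a b <= p -> a <= p \/ b <= p.

Definition primes_above c (x : L) : set L :=
  [set p | commutator_prime c p /\ x <= p].

(* is_radical c x r means rho(x) = r. It is a relation because rho(x) need not
   exist when L is not complete. *)
Definition is_radical c (x r : L) : Prop := infimums (primes_above c x) r.

Definition radical_equiv c (a b : L) : Prop :=
  exists r, is_radical c a r /\ is_radical c b r.

Definition radical_class c (a : L) : set L := [set b | radical_equiv c a b].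

End Commutators.

(* Main.v *)
(* As [rho(0) = 0], one has [x /\ y = 0] iff [c x y = 0]: a prime above [c x y]
   is above [x] or [y].  Since [c] distributes over joins, annihilators are
   ideals and [Ann U = ann (sup U)] whenever [c] respects the supremum of [U],
   so a condition on the sets [U] of a given size reduces to one on elements.
   Since moreover [c x 1 = x], every [x] is the join of its meets with [e] and
   [f] when [e], [f] are complements; thus complemented elements behave as in
   a distributive lattice, and [Ann a \/ Ann (Ann a) = L] splits [1] into a
   complemented generator of [Ann a] and its complement.  Under completeness,
   [Ann a] is principal, so [Ann (Ann a)] is itself the annihilator of an
   element and [(iv)] suffices. *)
Require Import Defs.
From mathcomp Require Import all_boot all_order.
From mathcomp Require Import mathcomp_extra boolp classical_sets functions.
From mathcomp Require Import cardinality.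

Set Implicit Arguments.
Unset Strict Implicit.
Unset Printing Implicit Defensive.

Import Order.TTheory.
Local Open Scope classical_set_scope.
Local Open Scope order_scope.

(** These are the bounds under which singletons are small, so that a condition on small sets can be
    specialised to a single element. *)
Definition inhabited_bound (b : size_bound) : Prop :=
  if b is AtMost K then inhabited K else True.

Lemma small_image b (T T' : Type) (f : T -> T') (U : set T) :
  small b U -> small b (f @` U).
Proof.
case: b => [K||] //=; last exact: finite_image.
exact/card_le_trans/card_image_le.
Qed.

Lemma small_set1 b (T : Type) (x : T) : inhabited_bound b -> small b [set x].
Proof.
case: b => [K [k]|_|] //=.
have -> : [set x] = (fun=> x) @` [set k].
  by apply/seteqP; split=> [y ->|y [_ _ <-]] //; exists k.
exact/(card_le_trans (card_image_le _ _))/subset_card_le.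
Qed.

(** * Generated ideals, and the embedding of elements as principal ideals *)

Section IdealGen.
Context {d : Order.disp_t} {L : tbLatticeType d}.

Lemma principal_is_ideal (e : L) : is_ideal [set x | x <= e].
Proof.
split=> [|x y xy /=|x y /=]; first exact: le0x.
- exact: le_trans.
- by rewrite leUx => -> ->.
Qed.

Definition principal (e : L) : ideal L := Ideal (principal_is_ideal e).

Lemma ideal_gen1 (e : L) : ideal_gen [set e] = [set x | x <= e].
Proof.
apply/seteqP; split=> x.
  by apply; split; [exact: principal_is_ideal|move=> _ -> /=].
move=> /= xe I [iI Ie]; apply: ideal_down xe _ => //; exact: Ie.
Qed.

Lemma principal_inj : injective principal.
Proof.
move=> e f ef; apply: le_anti.
have /seteqP[ef1 ef2] := congr1 (@ideal_set _ _) ef.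
by rewrite (ef1 e) ?(ef2 f) /=.
Qed.

(** The elements below some [y] ∨ [z] already form an ideal containing both. As [L] need not be
    distributive, membership is an inequality, not an equation. *)
Lemma ideal_gen_setU {I J : set L} {x : L} : is_ideal I -> is_ideal J ->
  ideal_gen (I `|` J)%classic x <-> exists y z, [/\ I y, J z & x <= y `|` z].
Proof.
move=> iI iJ; split=> [genx|[y [z [Iy Jz xyz]]] K [iK IJK]]; last first.
  apply: ideal_down xyz _ => //; apply: ideal_join => //.
    by apply: IJK; left.
  by apply: IJK; right.
apply: (genx [set u | exists y z, [/\ I y, J z & u <= y `|` z]]).
split=> [|y [Iy|Jy]]; last 2 first.
- by exists y, \bot; split=> //; [exact: ideal_bot|rewrite joinx0].
- by exists \bot, y; split=> //; [exact: ideal_bot|rewrite join0x].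
split=> [|u v uv [y [z [Iy Jz vyz]]]|u v [y [z [Iy Jz uyz]]]
    [y' [z' [Iy' Jz' vyz]]]].
- by exists \bot, \bot; split; [exact: ideal_bot..|exact: le0x].
- by exists y, z; split=> //; exact: le_trans vyz.
- exists (y `|` y'), (z `|` z'); split; [exact: ideal_join..|].
  by rewrite joinACA; exact: leU2.
Qed.

Lemma principalI (e f : L) : principal e `&` principal f = principal (e `&` f).
Proof.
apply: ideal_inj; apply/seteqP; split=> x /=.
  by case=> /= xe xf; rewrite lexI xe.
by rewrite lexI => /andP[].
Qed.

Lemma principalU (e f : L) : principal e `|` principal f = principal (e `|` f).
Proof.
apply: ideal_inj; apply/seteqP; split=> x /=.
  move=> /(ideal_gen_setU (principal_is_ideal e) (principal_is_ideal f)).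
  by case=> [y [z [ye zf xyz]]]; exact/(le_trans xyz)/leU2.
move=> xef; apply/(ideal_gen_setU (principal_is_ideal e) (principal_is_ideal f)).
by exists e, f; split=> /=.
Qed.

Lemma principal0 : principal \bot = \bot.
Proof.
apply: ideal_inj; apply/seteqP; split=> x /=; last by move=> ->.
by rewrite lex0 => /eqP.
Qed.

Lemma principal1 : principal \top = \top.
Proof. by apply: ideal_inj; apply/seteqP; split=> x //= _; exact: lex1. Qed.

Lemma principal_le (e f : L) : (principal e <= principal f) = (e <= f).
Proof.
apply/ideal_leP/idP => [/(_ e) /=|ef x /= xe]; first exact.
exact: le_trans ef.
Qed.

End IdealGen.

(** The two traces of the commutator on the lattice: 0-distributivity, which makes annihilators
    ideals, and the recovery of any element from its meets with two complements. *)
Record annihilator_friendly {d : Order.disp_t} (L : tbLatticeType d) : Prop :=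
  AnnihilatorFriendly {
    meet_join_eq0 : forall x y z : L,
      x `&` y = \bot -> x `&` z = \bot -> x `&` (y `|` z) = \bot;
    complement_split : forall x e f : L,
      e `&` f = \bot -> e `|` f = \top -> (x `&` e) `|` (x `&` f) = x
  }.

(** This is what the existence of joins contributes: a condition on small sets reduces to one on
    elements. *)
Definition ann_closed {d : Order.disp_t} (L : tbLatticeType d) b : Prop :=
  forall U : set L, small b U -> exists s, Ann U = ann s.

(** * Annihilators and complements *)

Section AnnihilatorFriendly.
Context {d : Order.disp_t} {L : tbLatticeType d}.
Context (friendL : annihilator_friendly L).
Implicit Types (x y z a e f : L) (U : set L).

Lemma ann_ideal a : is_ideal (ann a).
Proof.
split=> [|x y xy /= ya|x y /= xa ya]; first by rewrite /ann /= meet0x.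
- by apply/eqP; rewrite -lex0 -ya leI2.
- by rewrite /ann /= meetC (meet_join_eq0 friendL) // meetC.
Qed.

Lemma Ann_ideal U : is_ideal (Ann U).
Proof.
split=> [u _|x y xy yU u Uu|x y xU yU u Uu]; have iu := ann_ideal u.
- exact: ideal_bot.
- by apply: ideal_down xy _ => //; exact: yU.
- by apply: ideal_join => //; [exact: xU|exact: yU].
Qed.

Lemma Ann1 a : Ann [set a] = ann a.
Proof. exact: bigcap_set1. Qed.

Lemma Ann_ann_self a : Ann (ann a) a.
Proof. by move=> v va; rewrite /ann /= meetC. Qed.

(** If [x] ∧ [e] = 0, the splitting of [x] collapses to [x] = [x] ∧ [f]. Inequalities thus become
    vanishing meets, to which 0-distributivity applies. *)
Lemma le_complement x e f : e `|` f = \top -> e `&` f = \bot ->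
  (x <= f) = (x `&` e == \bot).
Proof.
move=> ef1 ef0; apply/idP/eqP => [xf|xe].
  by apply/eqP; rewrite -lex0 -ef0 meetC leI2.
by rewrite -(complement_split friendL x ef0 ef1) xe join0x leIr.
Qed.

Lemma le_complementl x e f : e `|` f = \top -> e `&` f = \bot ->
  (x <= e) = (x `&` f == \bot).
Proof. by move=> ef1 ef0; apply: le_complement; rewrite 1?joinC 1?meetC. Qed.

Lemma ann_complement e f : e `|` f = \top -> e `&` f = \bot ->
  ann e = [set x | x <= f].
Proof.
move=> ef1 ef0; apply/seteqP; split=> x; rewrite /ann /=.
  by move=> xe; rewrite (le_complement x ef1 ef0) xe.
by rewrite (le_complement x ef1 ef0) => /eqP.
Qed.

Lemma Ann_principal e : Ann [set x | x <= e] = ann e.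
Proof.
apply/seteqP; split=> x /=; first by apply => /=.
by move=> xe u /= ue; apply/eqP; rewrite -lex0 -xe leI2.
Qed.

(** De Morgan without distributivity: the second join contains [e'], and also [e], which splits into
    [e] ∧ [f] and a part below [f']. *)
Lemma complement_meet_join e f e' f' :
  e `&` e' = \bot -> e `|` e' = \top -> f `&` f' = \bot -> f `|` f' = \top ->
  (e `&` f) `&` (e' `|` f') = \bot /\ (e `&` f) `|` (e' `|` f') = \top.
Proof.
move=> e0 e1 f0 f1; split.
  apply: (meet_join_eq0 friendL).
    by rewrite meetAC e0 meet0x.
  by rewrite -meetA f0 meetx0.
apply/le_anti; rewrite lex1 -e1 /=.
rewrite leUx -{1}(complement_split friendL e f0 f1) leUx.
by rewrite leUl /= !(lexU2, leIr, lexx, orbT).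
Qed.

Lemma boolean_complemented : boolean_sublattice (complemented L).
Proof.
have cI x y : complemented L x -> complemented L y -> complemented L (x `&` y).
  move=> [x' [x0 x1]] [y' [y0 y1]]; exists (x' `|` y').
  exact: complement_meet_join.
have cU x y : complemented L x -> complemented L y -> complemented L (x `|` y).
  move=> [x' [x0 x1]] [y' [y0 y1]]; exists (x' `&` y').
  rewrite meetC [_ `|` (_ `&` _)]joinC.
  by apply: complement_meet_join; rewrite 1?meetC 1?joinC.
split=> //.
- by exists \top; rewrite meet0x join0x.
- by exists \bot; rewrite meetx0 joinx0.
- move=> x y z cx cy cz.
  have [v' [v0 v1]] := cU _ _ (cI _ _ cx cy) (cI _ _ cx cz).
  apply/le_anti; rewrite leUx !leI2 ?leUl ?leUr ?lexx // andbT.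
  rewrite (le_complementl _ v1 v0).
  (* [t] is the part of [x] ∧ ([y] ∨ [z]) lying below the complement of ([x] ∧ [y]) ∨ ([x] ∧ [z]).
     It meets [y] and [z] in 0, hence also [y] ∨ [z], which is above it; so it vanishes. *)
  set t := _ `&` v'.
  have t0 u : x `&` u <= x `&` y `|` x `&` z -> t `&` u = \bot.
    move=> uv; apply/eqP; rewrite -lex0 -v0 lexI (le_trans _ uv).
      by rewrite leIxl ?leIr.
    by rewrite leI2 // leIxl ?leIl.
  have <- : t `&` (y `|` z) = t by apply/meet_idPl; rewrite leIxl ?leIr.
  rewrite andbT; apply/eqP; apply: (meet_join_eq0 friendL); apply: t0.
    by rewrite leUl.
  by rewrite leUr.
- move=> x [y [xy0 xy1]]; exists y => //.
  by exists x; rewrite meetC joinC.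
Qed.

Lemma stoneP : stone L <-> forall a, exists e f,
  [/\ e `&` f = \bot, e `|` f = \top & ann a = [set x | x <= e]].
Proof.
split=> [+ a|+ a] => /(_ a).
  by case=> e [f [ef0 ef1]]; rewrite ideal_gen1 => aE; exists e, f.
by case=> e [f [ef0 ef1 aE]]; exists e; [exists f|rewrite ideal_gen1].
Qed.

Lemma Ann_Ann_ann a : stone L -> exists e f,
  [/\ e `&` f = \bot, e `|` f = \top, ann a = [set x | x <= e] &
      Ann (ann a) = [set x | x <= f]].
Proof.
move=> /stoneP/(_ a)[e [f [ef0 ef1 aE]]]; exists e, f; split=> //.
by rewrite aE Ann_principal (ann_complement ef1 ef0).
Qed.

Lemma ann_double_stone :
  (forall a, ideal_gen (ann a `|` Ann (ann a))%classic = [set: L]) <-> stone L.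
Proof.
split=> [annL|stoneL a]; last first.
  have [e [f [_ ef1 aE aaE]]] := Ann_Ann_ann a stoneL.
  apply/seteqP; split=> x //= _.
  apply/(ideal_gen_setU (ann_ideal a) (Ann_ideal _)).
  by exists e, f; split; rewrite ?aaE ?aE ?ef1 ?lex1 /=.
apply/stoneP => a.
(* Write 1 as [e] ∨ [f] with [e] in [ann a] and [f] in [Ann (ann a)]. Every member of [ann a] meets
   [f] in 0, and so lies below [e]. *)
have : [set: L] \top by [].
rewrite -(annL a) => /(ideal_gen_setU (ann_ideal a) (Ann_ideal _)).
case=> e [f [ae aaf ef1]].
have {}ef1 : e `|` f = \top by apply/eqP; rewrite eq_le lex1.
have ef0 : e `&` f = \bot by rewrite meetC; exact: aaf.
exists e, f; split=> //; apply/seteqP; split=> x /=.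
  move=> xa; rewrite (le_complementl x ef1 ef0).
  by rewrite meetC; apply/eqP; exact: aaf.
by move=> xe; apply: ideal_down xe ae; exact: ann_ideal.
Qed.

Lemma stone_ann_meet : stone L -> condition_iv L.
Proof.
move=> /stoneP stoneL a b; apply/seteqP; split=> x; last first.
  move=> /(ideal_gen_setU (ann_ideal a) (ann_ideal b))[y [z [ya zb xyz]]].
  apply: ideal_down xyz _; first exact: ann_ideal.
  apply: ideal_join; first exact: ann_ideal.
    by rewrite /ann /= meetA ya meet0x.
  by rewrite /ann /= meetCA zb meetx0.
move=> xab; apply/(ideal_gen_setU (ann_ideal a) (ann_ideal b)).
have [e [e' [e0 e1 aE]]] := stoneL a.
have [f [f' [f0 f1 bE]]] := stoneL b.
(* From [x] ∧ [a] ≤ [f] it follows that [x] ∧ [f'] annihilates [a], so it is below [e]; the other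
   half of [x], namely [x] ∧ [f], is below [f]. *)
exists e, f; split; rewrite ?aE ?bE //=.
have : ann b (x `&` a) by rewrite /ann /= -meetA.
rewrite bE /= (le_complementl _ f1 f0) => /eqP xaf.
have : ann a (x `&` f') by rewrite /ann /= meetAC.
rewrite aE /= => xfe; rewrite -(complement_split friendL x f0 f1) leUx.
by rewrite (le_trans xfe (leUl _ _)) (le_trans (leIr _ _) (leUr _ _)).
Qed.

(** * Completeness of the Boolean centre, and condition (3) *)

Lemma stone_Ann b U : ann_closed L b -> stone L -> small b U ->
  exists e f, [/\ e `&` f = \bot, e `|` f = \top & Ann U = [set x | x <= e]].
Proof.
by move=> closedL /stoneP stoneL /closedL[s ->]; exact: stoneL.
Qed.

(** The supremum of [U] is the complement of the generator of [Ann U]. Dually, the infimum generates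
    the annihilator of a set of complements of members of [U]. *)
Lemma stone_complete b : ann_closed L b -> stone L ->
  complete_boolean_sublattice b (complemented L).
Proof.
move=> closedL stoneL; split; first exact: boolean_complemented.
suff complete : forall U, (U `<=` complemented L)%classic -> small b U ->
    has_sup_in (complemented L) U /\ has_inf_in (complemented L) U.
  by case: b closedL complete.
move=> U UB smallU; split.
  have [e [f [e0 e1 UE]]] := stone_Ann closedL stoneL smallU.
  exists f; split=> [|u Uu|t [t' [t0 t1]] Ut].
  - by exists e; rewrite meetC joinC.
  - rewrite (le_complement u e1 e0) meetC; apply/eqP.
    by have Ue : Ann U e; [rewrite UE /=|exact: Ue].
  - have : Ann U t'.
      move=> u /Ut ut; apply/eqP; rewrite -lex0 -t0 meetC leI2 //.
    rewrite UE /= => te.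
    rewrite (le_complementl f t1 t0).
    by rewrite -lex0 -e0 meetC leI2.
(* [g] chooses a complement of each member of [U]; its value outside [U] is irrelevant. *)
have /choice[g gP] : forall u, exists v,
    U u -> u `&` v = \bot /\ u `|` v = \top.
  move=> u.
  have [/UB[v uv]|nUu] := pselect (U u); first by exists v.
  by exists \bot.
have [e [f [e0 e1 UE]]] := stone_Ann closedL stoneL (small_image g smallU).
have compl u t : U u -> (t <= u) = (t `&` g u == \bot).
  move=> /gP[u0 u1]; exact: le_complementl.
exists e; split=> [|u Uu|t _ tU].
- by exists f.
- rewrite (compl _ _ Uu); apply/eqP.
  by have Ue : Ann (g @` U) e; [rewrite UE /=|apply: Ue; exists u].
- suff : Ann (g @` U) t by rewrite UE.
  by move=> _ [u Uu <-]; apply/eqP; rewrite -(compl _ _ Uu) tU.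
Qed.

(** If [e] and [f] are complements, [ann e] is the ideal below [f] and conversely. Hence [principal]
    carries the complemented elements onto [P2Ann L], along with their Boolean structure. *)
Lemma P2Ann_principal : stone L ->
  [set I : ideal L | P2Ann L (ideal_set I)] = principal @` complemented L.
Proof.
move=> stoneL; apply/seteqP; split=> I /=.
  case=> a _ aI; have [e [f [e0 e1 _ aaE]]] := Ann_Ann_ann a stoneL.
  exists f; first by exists e; rewrite meetC joinC.
  by apply: ideal_inj; rewrite -aI aaE.
case=> e [f [e0 e1]] <-; exists e => //=.
by rewrite (ann_complement e1 e0) Ann_principal (@ann_complement f e) 1?joinC 1?meetC.
Qed.

Lemma boolean_principal (S : set L) :
  boolean_sublattice S -> boolean_sublattice (principal @` S).
Proof.
case=> S0 S1 SI SU SD SC; split.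
- by exists \bot => //; exact: principal0.
- by exists \top => //; exact: principal1.
- by move=> _ _ [x Sx <-] [y Sy <-]; rewrite principalI; exists (x `&` y); auto.
- by move=> _ _ [x Sx <-] [y Sy <-]; rewrite principalU; exists (x `|` y); auto.
- move=> _ _ _ [x Sx <-] [y Sy <-] [z Sz <-].
  by rewrite !(principalI, principalU) SD.
- move=> _ [x Sx <-]; have [y Sy [xy0 xy1]] := SC x Sx.
  exists (principal y); first by exists y.
  by rewrite principalI principalU xy0 xy1 principal0 principal1.
Qed.

(** Suprema and infima are computed inside [S], and [principal] is an order isomorphism of [S] onto
    its image. *)
Lemma complete_principal b (S : set L) : complete_boolean_sublattice b S ->
  complete_boolean_sublattice b (principal @` S).
Proof.
case=> bS complete; split; first exact: boolean_principal.
have {}complete : b <> FiniteSize -> forall U, (U `<=` S)%classic -> small b U ->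
    has_sup_in S U /\ has_inf_in S U by case: b complete.
suff : b <> FiniteSize -> forall U : set (ideal L), (U `<=` principal @` S)%classic ->
    small b U -> has_sup_in (principal @` S) U /\ has_inf_in (principal @` S) U.
  by case: b {complete} => [K||] //; apply.
move=> bF U US smallU.
(* The generator of a principal ideal, with ⊥ as the default on other ideals; [U] is pulled back
   along it. *)
pose gen (I : ideal L) := xget \bot [set e | principal e = I].
have genK e : gen (principal e) = e.
  apply: principal_inj; rewrite /gen; case: xgetP => [_ _ //|/(_ e)] /=.
  by [].
have US' : (gen @` U `<=` S)%classic.
  by move=> _ [I /US[e Se <-] <-]; rewrite genK.
have UE e : S e -> U (principal e) -> (gen @` U) e.
  by move=> _ Ue; exists (principal e).
have [[s [Ss us sl]] [i [Si li il]]] := complete bF _ US' (small_image gen smallU).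
split.
  exists (principal s); split=> [|I /[dup] UI /US[e Se eI]|_ [t St <-] Ut].
  - by exists s.
  - by subst I; rewrite principal_le us //; exact: UE.
  - rewrite principal_le; apply: sl => // _ [I UI <-].
    have [e Se eI] := US _ UI.
    by rewrite -eI genK -principal_le eI; exact: Ut.
exists (principal i); split=> [|I /[dup] UI /US[e Se eI]|_ [t St <-] Ut].
- by exists i.
- by subst I; rewrite principal_le li //; exact: UE.
- rewrite principal_le; apply: il => // _ [I UI <-].
  have [e Se eI] := US _ UI.
  by rewrite -eI genK -principal_le eI; exact: Ut.
Qed.

Lemma stone_condition3 b : ann_closed L b -> stone L -> condition3 L b.
Proof.
move=> closedL stoneL; pose AA a := Ideal (Ann_ideal (ann a)).
have ivL := stone_ann_meet stoneL.
exists AA; split=> //.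
- by rewrite P2Ann_principal //; exact/complete_principal/stone_complete.
- move=> a b'; apply: ideal_inj; apply/seteqP; split=> x /=.
    move=> xab; split=> u ua; apply: xab; rewrite ivL => I [iI]; apply.
      by left.
    by right.
  (* By (iv), [u] is below some [y] ∨ [z] with [y] in [ann a] and [z] in [ann b']; [x] meets both in
     0, hence their join. *)
  case=> xa xb u; rewrite ivL.
  move=> /(ideal_gen_setU (ann_ideal a) (ann_ideal b'))[y [z [ya zb uyz]]].
  apply/eqP; rewrite -lex0; apply: (@le_trans _ _ (x `&` (y `|` z))).
    by rewrite leI2.
  by rewrite (meet_join_eq0 friendL (xa _ ya) (xb _ zb)).
- move=> a b'; apply: ideal_inj => /=.
  have [e [e' [e0 e1 aE aaE]]] := Ann_Ann_ann a stoneL.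
  have [f [f' [f0 f1 bE bbE]]] := Ann_Ann_ann b' stoneL.
  (* The double annihilator of the join is therefore [ann] of [e] ∧ [f], to which (iv) applies. *)
  have -> : ann (a `|` b') = [set x | x <= e `&` f].
    apply/seteqP; split=> x /=; rewrite lexI.
      move=> xab; apply/andP; split.
        have : ann a x; last by rewrite aE.
        by apply/eqP; rewrite -lex0 -xab leI2 ?leUl.
      have : ann b' x; last by rewrite bE.
      by apply/eqP; rewrite -lex0 -xab leI2 ?leUr.
    move=> /andP[xe xf]; apply: (meet_join_eq0 friendL).
      by have : ann a x by rewrite aE.
    by have : ann b' x by rewrite bE.
  by rewrite Ann_principal ivL -(Ann_principal e) -(Ann_principal f) -aE -bE.
Qed.

(** Let [J] be the complement of [Ann (ann a)]. For [x] in [J], the element [x] ∧ [a] lies in both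
    ideals, so it is 0. Thus [J] is inside [ann a], and [ann a] and [Ann (ann a)] generate [L]. *)
Lemma condition3_stone b : condition3 L b -> stone L.
Proof.
case=> AA [AAE [bP _] _ _]; apply/ann_double_stone => a.
have /(bsub_compl bP)[J [b' _ bJ] [aJ0 aJ1]] : P2Ann L (AA a) by exists a.
have J_ann x : ideal_set J x -> ann a x.
  move=> Jx; suff : ideal_set \bot (x `&` a) by [].
  rewrite -aJ0; split; last by apply: (ideal_down (ideal_setP J)) Jx; rewrite leIl.
  by rewrite AAE; exact: (ideal_down (Ann_ideal _) (leIr _ _) (@Ann_ann_self a)).
apply/seteqP; split=> x //= _.
have : ideal_set \top x by [].
rewrite -aJ1 => /(ideal_gen_setU (ideal_setP _) (ideal_setP _)).
case=> y [z [ya zJ xyz]].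
apply/(ideal_gen_setU (ann_ideal a) (Ann_ideal _)).
by exists z, y; split; [exact: J_ann|rewrite -AAE|rewrite joinC].
Qed.

Lemma ann_meet_P2Ann_stone :
  condition_iv L /\ (P2Ann L `<=` PAnn L)%classic <-> stone L.
Proof.
split=> [[ivL annL]|stoneL]; last first.
  split=> [|_ [a _ <-]]; first exact: stone_ann_meet.
  have [e [f [_ _ -> _]]] := Ann_Ann_ann a stoneL.
  by rewrite Ann_principal; exists e.
apply/ann_double_stone => a.
(* Writing [Ann (ann a)] as [ann b] gives [a] ∧ [b] = 0, and (iv) turns the ideal join into the
   annihilator of 0, which is [L]. *)
have [|b _ abE] := annL (Ann (ann a)); first by exists a.
rewrite -abE -ivL; apply/seteqP; split=> x //= _; rewrite /ann /=.
suff -> : a `&` b = \bot by rewrite meetx0.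
by have := @Ann_ann_self a; rewrite -abE.
Qed.

(** The hub of all the equivalences. For conditions (1), (4) and (5), singletons lead to [stone]; in
    the other direction, [ann_closed] replaces a small set by one element wherever such sets
    occur. *)
Lemma condition_stone b n : inhabited_bound b -> ann_closed L b ->
  (1 <= n <= 5)%N -> condition L n b <-> stone L.
Proof.
move=> ib closedL; case: n => [|[|[|[|[|[|n]]]]]] //= _.
- split=> [cond a|stoneL U smallU].
    by rewrite -Ann1; apply: cond; exact: small_set1.
  have [e [f [e0 e1 ->]]] := stone_Ann closedL stoneL smallU.
  by exists e; [exists f|rewrite ideal_gen1].
- by split=> [[]|stoneL] //; split=> //; exact: stone_complete.
- by split; [exact: condition3_stone|exact: stone_condition3].
- split=> [[ivL annL]|stoneL].
    apply/ann_meet_P2Ann_stone; split=> // _ [a _ <-].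
    by rewrite -Ann1; apply: annL; exact: small_set1.
  split; first exact: stone_ann_meet.
  move=> U smallU; have [e [f [e0 e1 ->]]] := stone_Ann closedL stoneL smallU.
  by rewrite Ann_principal; exists e.
- split=> [cond|stoneL U smallU].
    apply/ann_double_stone => a.
    by have := cond [set a] (small_set1 a ib); rewrite Ann1.
  have [s ->] := closedL U smallU.
  by have /ann_double_stone := stoneL; exact.
Qed.

End AnnihilatorFriendly.

(** * From the commutator to annihilators, and primes above proper elements *)

Section Commutators.
Context {d : Order.disp_t} {L : tbLatticeType d}.
Context (c : L -> L -> L).
Context (cC : forall x y, c x y = c y x) (c_le : forall x y, c x y <= x `&` y).
Context (cU : forall x y z, c x (y `|` z) = c x y `|` c x z).
Context (c_top : forall x, c x \top = x).
Implicit Types (x y : L) (U : set L).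

Lemma commutator_eq0 x y : is_radical c \bot \bot ->
  c x y = \bot <-> x `&` y = \bot.
Proof.
case=> _ rho0; split=> [cxy|xy]; last first.
  by apply/eqP; rewrite -lex0 -xy c_le.
apply/eqP; rewrite -lex0; apply: rho0 => p [[_ pprime] _].
by case: (pprime x y) => [|xp|yp]; [rewrite cxy le0x|exact: leIxl|exact: leIxr].
Qed.

Lemma commutator_friendly : is_radical c \bot \bot -> annihilator_friendly L.
Proof.
move=> rho0; split=> [x y z|x e f ef0 ef1].
  move=> /(commutator_eq0 _ _ rho0) xy /(commutator_eq0 _ _ rho0) xz.
  by apply/(commutator_eq0 _ _ rho0); rewrite cU xy xz joinxx.
(* Here [x] = [c x 1] = [c x e] ∨ [c x f], and [c] lies below the meet. *)
apply/le_anti; rewrite leUx !leIl /= -{1}(c_top x) -ef1 cU.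
by rewrite leU2 ?c_le.
Qed.

Lemma sup_commutator_ann b U s : is_radical c \bot \bot ->
  commutator_operation b c -> small b U -> supremums U s -> Ann U = ann s.
Proof.
move=> rho0 cop smallU Us; apply/seteqP; split=> x /=; last first.
  by move=> xs u Uu; apply/eqP; rewrite -lex0 -xs leI2 //; apply: Us.1.
move=> xU; apply/(commutator_eq0 _ _ rho0)/eqP; rewrite -lex0.
apply: (commutator_sup cop x smallU Us).2 => _ [u Uu <-].
by rewrite lex0; apply/eqP/(commutator_eq0 _ _ rho0); exact: xU.
Qed.

(** As for maximal ideals of a ring: Zorn yields a maximal element among the proper elements above
    [x], and maximality together with [c 1 1] = 1 makes it prime. *)
Lemma prime_above_of_compact_top : compact_element (\top : L) ->
  forall x, x <> \top -> exists p, primes_above c x p.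
Proof.
move=> top_compact x x_neq1; pose T := {y : L | x <= y /\ y <> \top}.
pose R (s t : T) := sval s <= sval t.
have [||||[m [xm m_neq1]] max_m] := @Zorn T R.
- by move=> s; exact: lexx.
- by move=> r s t; exact: le_trans.
- move=> [s hs] [t ht] st ts; apply: eq_exist => /=.
  by apply: le_anti; apply/andP; split.
- move=> A A_chain; apply: contrapT => noub.
  have [[a0 Aa0]|A0] := pselect (exists t, A t); last first.
    apply: noub; exists (exist _ x (conj (lexx x) x_neq1)) => s As.
    by case: A0; exists s.
  (* An upper bound of the chain other than 1 would belong to [T]. So 1 is the supremum, and by
     compactness a finite join, hence a single member of the chain, would reach 1. *)
  have sup1 : supremums (sval @` A) \top.
    split=> [y _|t At]; first exact: lex1.
    have [->//|t_neq1] := eqVneq t \top.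
    have xt : x <= t by apply: le_trans (svalP a0).1 _; apply: At; exists a0.
    case: noub; exists (exist _ t (conj xt (elimN eqP t_neq1))) => s As.
    by apply: At; exists s.
  have [F FA F1] := top_compact _ _ sup1 (lexx _).
  have [s As Fs] : exists2 s, A s & \join_(y <- F) y <= sval s.
    elim: F FA {F1} => [|y F IH] FA; first by exists a0; rewrite ?big_nil ?le0x.
    have [|s As Fs] := IH; first by move=> z zF; apply: FA; rewrite inE zF orbT.
    have [t At ty] : (sval @` A) y by apply: FA; rewrite inE eqxx.
    have [st|ts] := A_chain s t As At.
      by exists t => //; rewrite big_cons leUx -ty lexx (le_trans Fs).
    by exists s => //; rewrite big_cons leUx -ty Fs andbT.
  by case: (svalP s) => _; apply; apply/eqP; rewrite eq_le lex1 (le_trans F1).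
exists m; split=> //; split=> // a b abm; apply: contrapT => /not_orP[am bm].
have joinm1 y : ~ y <= m -> y `|` m = \top.
  move=> ym; apply: contrapT => ym_neq1.
  have xym : x <= y `|` m by rewrite lexUr.
  have := max_m (exist _ _ (conj xym ym_neq1)) (leUr _ _).
  by move=> /(congr1 sval) /= ymE; apply: ym; rewrite -ymE leUl.
(* Expand 1 = [c] ([a] ∨ [m]) ([b] ∨ [m]): the term [c a b] is below [m] by assumption, and each
   other term has [m] as an argument. *)
apply: (m_neq1); apply/eqP; rewrite eq_le lex1 /= -(c_top \top).
rewrite -{1}(joinm1 _ am) -(joinm1 _ bm) cU cC cU (cC b a) !leUx abm /=.
by rewrite !(le_trans (c_le _ _)) ?leIl ?leIr.
Qed.

Lemma radical_class_top : compact_element (\top : L) ->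
  radical_class c \top = [set \top].
Proof.
move=> top_compact; apply/seteqP; split=> x /=; last first.
  move=> ->; exists \top; suff inf1 : is_radical c \top \top by [].
  split=> [p [_ //]|y _]; exact: lex1.
case=> r [[_ r_inf] [r_lb _]]; apply: contrapT => x_neq1.
(* No prime lies above 1, so [r] is an infimum of the empty set. *)
have r1 : \top <= r.
  apply: r_inf => p [[p_neq1 _] p1].
  by case: p_neq1; apply/eqP; rewrite eq_le lex1.
have [p xp] := prime_above_of_compact_top top_compact x_neq1.
by case: xp (r_lb p xp) => [[+ _] _] rp; apply; apply/eqP; rewrite eq_le lex1 (le_trans r1).
Qed.

End Commutators.

(** * Finite and complete cases, and the final equivalences *)

Lemma commutator_join_any {d : Order.disp_t} (L : tbLatticeType d)
    (c : L -> L -> L) (x y z : L) :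
  commutator_operation AnySize c -> c x (y `|` z) = c x y `|` c x z.
Proof.
move=> cop.
have [|ub_c lub_c] := @commutator_sup _ _ _ _ cop x [set y; z] (y `|` z) I.
  split=> [_ [->|->]|t yzt]; rewrite ?leUl ?leUr //.
  by rewrite leUx; apply/andP; split; apply: yzt; [left|right].
apply/le_anti; rewrite leUx !ub_c ?andbT; last 2 first.
- by exists z => //; right.
- by exists y => //; left.
by apply: lub_c => _ [_ [->|->] <-]; rewrite ?leUl ?leUr.
Qed.

(** Finite joins are handled by iterating 0-distributivity, since a finite set may exceed the
    cardinality for which [c] is assumed to respect suprema. *)
Lemma ann_closed_finite {d : Order.disp_t} (L : tbLatticeType d) :
  annihilator_friendly L -> ann_closed L FiniteSize.
Proof.
move=> friendL U /finite_seqP[F ->]; exists (\join_(x <- F) x).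
apply/seteqP; split=> x /=; last first.
  move=> xF u uF; apply/eqP; rewrite -lex0 -xF leI2 //.
  exact: joins_sup_seq.
elim: F => [|y F IH] xF; first by rewrite /ann /= big_nil meetx0.
rewrite /ann /= big_cons; apply: (meet_join_eq0 friendL).
  by apply: xF; rewrite /= inE eqxx.
by apply: IH => u uF; apply: xF; rewrite /= inE; apply/orP; right.
Qed.

Lemma ann_meet_stone {d : Order.disp_t} (L : tbLatticeType d) :
  annihilator_friendly L -> (forall a : L, exists s, ann a = [set x | x <= s]) ->
  condition_iv L -> stone L.
Proof.
move=> friendL principalL ivL; apply/(ann_meet_P2Ann_stone friendL).
split=> // _ [a _ <-]; have [s ->] := principalL a.
by rewrite Ann_principal; exists s.
Qed.

Lemma complete_ann_principal {d : Order.disp_t} (L : tbLatticeType d)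
    (c : L -> L -> L) : is_radical c \bot \bot -> commutator_lattice c ->
  forall a : L, exists s, ann a = [set x | x <= s].
Proof.
move=> rho0 [complete cop] a; have [[s [ub_s lub_s]] _] := complete (ann a).
exists s; apply/seteqP; split=> x; first exact: ub_s.
move=> /= xs; have c_le := commutator_le cop.
(* [a] annihilates every member of [ann a], hence also their supremum [s]. *)
have : ann s a.
  rewrite -(sup_commutator_ann c_le rho0 cop I (conj ub_s lub_s)).
  by move=> u ua; rewrite /ann /= meetC.
by move=> as0; apply/eqP; rewrite -lex0 -as0 meetC leI2.
Qed.

Theorem theorem6p21 (d : Order.disp_t) (L : tbLatticeType d)
    (c : L -> L -> L)
    (rho_bot : is_radical c \bot \bot)
    (comm_top : forall x : L, c x \top = x) :
  (commutator_lattice c ->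
    (compact_element (\top : L) -> radical_class c \top = [set \top]) /\
    (radical_class c \top = [set \top] ->
      (forall (h i j : nat) (K : Type),
         (1 <= h <= 5)%N -> (1 <= i <= 5)%N -> (1 <= j <= 5)%N ->
         inhabited K ->
         [<-> condition_iv L;
              condition L h (AtMost K);
              condition L i FiniteSize;
              condition L j AnySize]) /\
      [<-> stone L;
           condition1 L AnySize /\
             complete_boolean_sublattice AnySize (complemented L);
           condition3 L FiniteSize;
           condition3 L AnySize;
           (forall a b : L,
              ann (a `&` b) = ideal_gen (ann a `|` ann b)%classic);
           (forall a : L,
              ideal_gen (ann a `|` Ann (ann a))%classic = [set: L])]))
  /\
  (forall M : Type, inhabited M -> small_commutator_lattice M c ->
    (compact_element (\top : L) -> radical_class c \top = [set \top]) /\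
    (radical_class c \top = [set \top] ->
      (forall (h i : nat) (K : Type),
         (1 <= h <= 5)%N -> (1 <= i <= 5)%N ->
         inhabited K -> ([set: K] #<= [set: M])%card ->
         condition L h (AtMost K) <-> condition L i FiniteSize) /\
      [<-> stone L;
           condition1 L (AtMost M) /\
             complete_boolean_sublattice (AtMost M) (complemented L);
           condition3 L FiniteSize;
           condition3 L (AtMost M);
           (forall a b : L,
              ann (a `&` b) = ideal_gen (ann a `|` ann b)%classic) /\
             (P2Ann L `<=` PAnn L)%classic;
           (forall a : L,
              ideal_gen (ann a `|` Ann (ann a))%classic = [set: L])])).
Proof.
split=> [cL|M inhM [supM cop cU]].
  have [complete cop] := cL.
  have cU x y z := commutator_join_any x y z cop.
  have cC := commutatorC cop; have c_le := commutator_le cop.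
  split; first exact: radical_class_top.
  move=> _; have friendL := commutator_friendly c_le cU comm_top rho_bot.
  have closedL b : ann_closed L b.
    move=> U _; have [[s Us] _] := complete U; exists s.
    exact: (sup_commutator_ann c_le rho_bot cop I Us).
  have ivS : condition_iv L <-> stone L.
    split; last exact: stone_ann_meet.
    exact: (ann_meet_stone friendL (complete_ann_principal rho_bot cL)).
  split=> [h i j K h5 i5 j5 inhK|].
    have hS := condition_stone friendL (b := AtMost K) inhK (closedL _) h5.
    have iS := condition_stone friendL (b := FiniteSize) Logic.I (closedL _) i5.
    have jS := condition_stone friendL (b := AnySize) Logic.I (closedL _) j5.
    by tfae; tauto.
  have S1 := condition_stone friendL (b := AnySize) (n := 1) Logic.I (closedL _) isT.
  have S2 := stone_complete friendL (closedL AnySize).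
  have S3 := condition_stone friendL (b := AnySize) (n := 3) Logic.I (closedL _) isT.
  have F3 := condition_stone friendL (b := FiniteSize) (n := 3) Logic.I (closedL _) isT.
  have S5 := ann_double_stone friendL.
  rewrite /= in S1 S3 F3; rewrite /condition_iv in ivS.
  by tfae; tauto.
have cC := commutatorC cop; have c_le := commutator_le cop.
split; first exact: radical_class_top.
move=> _; have friendL := commutator_friendly c_le cU comm_top rho_bot.
have finL := ann_closed_finite friendL.
(* A set of size at most [K] also has size at most [M], so it has a supremum that [c] respects. *)
have closedL (K : Type) : ([set: K] #<= [set: M])%card -> ann_closed L (AtMost K).
  move=> KM U UK; have UM : small (AtMost M) U := card_le_trans UK KM.
  have [s Us] := supM U UM; exists s.
  exact: (sup_commutator_ann c_le rho_bot cop UM Us).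
split=> [h i K h5 i5 inhK KM|].
  have hS := condition_stone friendL (b := AtMost K) inhK (closedL _ KM) h5.
  have iS := condition_stone friendL (b := FiniteSize) Logic.I finL i5.
  by rewrite hS iS.
have MM := closedL M (card_lexx _).
have S1 := condition_stone friendL (b := AtMost M) (n := 1) inhM MM isT.
have S2 := stone_complete friendL MM.
have S3 := condition_stone friendL (b := AtMost M) (n := 3) inhM MM isT.
have F3 := condition_stone friendL (b := FiniteSize) (n := 3) Logic.I finL isT.
have S5 := ann_double_stone friendL.
have ivS := ann_meet_P2Ann_stone friendL.
rewrite /= in S1 S3 F3; rewrite /condition_iv in ivS.
by tfae; tauto.
Qed.
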